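(* Let $q$ be an odd prime power, $n$ a positive integer, and $f(x,y,z)=x(y+z)$ viewed as a function from $M_n(\mathbb{F}_q)^3$ to $M_n(\mathbb{F}_q)$. There are constants $C_0,c>0$ (independent of $q$ and the sets) such that for all $A,B,C\subset M_n(\mathbb{F}_q)$ with $|A||B||C|\ge C_0\, q^{3n^2-1}$ we have $|f(A,B,C)|\ge c\, q^{n^2}$.
   Context: $M_n(\mathbb{F}_q)$ is the ring of $n\times n$ matrices over $\mathbb{F}_q$, and $f(A,B,C)=\{a(b+c): a\in A,b\in B,c\in C\}$. *)

(* Defs.v *)
From HB Require Import structures.
From mathcomp Require Import all_boot all_order all_algebra.
From mathcomp Require Import reals.

Set Implicit Arguments.
Unset Strict Implicit.
Unset Printing Implicit Defensive.

Import Order.TTheory GRing.Theory Num.Theory.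
Local Open Scope ring_scope.

Definition mxf (F : finFieldType) (n : nat) (x y z : 'M[F]_n) : 'M[F]_n :=
  x *m (y + z).

Definition image3 (T U : finType) (f : T -> T -> T -> U) (A B C : {set T})
    : {set U} :=
  [set w | [exists a in A, exists b in B, exists c in C, w == f a b c]].

(* Main.v *)
(** After discarding the singular matrices of [A], which number at most
    [n * q ^ (n ^ 2 - 1)], every [(a, b, c)] gives a solution of
    [x t - b = c] with [x = a^-1] and [t = a (b + c)] in the image [T].
    For pairs [(t, b)] of matrices, the number of solutions [(x, c)] has mean
    [|A| |C| / q ^ (n ^ 2)]; its second moment counts the solutions [t] of
    [(x - x') t = c - c'], which is unique unless [x - x'] is singular, so
    the total variance is at most [n |A| |C| q ^ (2 n ^ 2 - 1)].
    Cauchy-Schwarz on [T * B] then shows that a set [T] of density below [1/2]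
    cannot receive all of [A * B * C]. *)
Require Import Defs.
From HB Require Import structures.
From mathcomp Require Import all_boot all_order all_algebra.
From mathcomp Require Import reals.
From mathcomp Require Import zify ring lra.

Set Implicit Arguments.
Unset Strict Implicit.
Unset Printing Implicit Defensive.

Import Order.TTheory GRing.Theory Num.Theory.
Local Open Scope ring_scope.

Lemma sum_mem_bij (T : finType) (f : T -> T) (C : {set T}) :
  injective f -> (\sum_t (f t \in C) = #|C|)%N.
Proof.
move=> injf; rewrite -sum1_card [RHS](reindex_inj injf) [RHS]big_mkcond /=.
by apply: eq_bigr => t _; case: (f t \in C).
Qed.

(** Cauchy-Schwarz against the constant 1: with [k] terms of sum [s], the nonnegative sum of the
    [(k * f i - s) ^+ 2] is [k] times the difference of the two sides. *)
Lemma sqr_sum_le_card (R : realFieldType) (I : finType) (P : pred I)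
    (f : I -> R) :
  (\sum_(i | P i) f i) ^+ 2 <= #|P|%:R * \sum_(i | P i) f i ^+ 2.
Proof.
set s := \sum_(i | P i) f i; set k : R := #|P|%:R.
have [P0|P_gt0] := posnP #|P|.
  have /eqP s0 : s == 0.
    by rewrite /s big_pred0 // => i; apply: (card0_eq P0).
  by rewrite s0 /k P0 mul0r expr0n.
have k_gt0 : 0 < k by rewrite /k ltr0n.
have : 0 <= \sum_(i | P i) (k * f i - s) ^+ 2.
  by apply: sumr_ge0 => i _; apply: sqr_ge0.
have -> : \sum_(i | P i) (k * f i - s) ^+ 2 =
    k * (k * (\sum_(i | P i) f i ^+ 2) - s ^+ 2).
  under eq_bigr => i _.
    rewrite (_ : _ ^+ 2 = k ^+ 2 * f i ^+ 2 - 2 * k * s * f i + s ^+ 2);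
      last by ring.
    over.
  rewrite big_split sumrB /= -!mulr_sumr sumr_const -/s -mulr_natr -/k.
  by ring.
by rewrite pmulr_rge0 // subr_ge0.
Qed.

Section SingularMatrices.
Variable F : finFieldType.

(** A parametrization, possibly with repetitions, whose image contains every singular matrix, so
    that counting the triples [p] bounds their number. *)
Definition dependent_row_mx m (p : 'I_m.+1 * 'rV[F]_m * 'M[F]_(m, m.+1)) :
    'M[F]_m.+1 :=
  let: (i, u, M) := p in
  \matrix_(k, j) if unlift i k is Some l then M l j else (u *m M) 0 j.

(** A nonzero [v] with [v *m A = 0] has some entry [v 0 i] that is nonzero; dividing the relation by
    it expresses row [i] through the other rows. *)
Lemma singular_dependent_row m (A : 'M[F]_m.+1) :
  A \notin unitmx -> exists p, A = dependent_row_mx p.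
Proof.
rewrite unitmxE unitfE negbK => /det0P[v /rV0Pn[i vi0] vA0].
exists (i, \row_l (- (v 0 i)^-1 * v 0 (lift i l)), row' i A).
apply/matrixP => k j; rewrite mxE.
case: unliftP => [l ->|->]; first by rewrite mxE.
have /matrixP/(_ 0 j) := vA0; rewrite !mxE (bigD1_ord i) //= => /eqP.
rewrite addrC addr_eq0 => /eqP vE.
have -> : \sum_l (\row_l (- (v 0 i)^-1 * v 0 (lift i l))) 0 l * row' i A l j =
    - (v 0 i)^-1 * \sum_l v 0 (lift i l) * A (lift i l) j.
  by rewrite mulr_sumr; apply: eq_bigr => l _; rewrite !mxE mulrA.
by rewrite vE mulrNN mulKf.
Qed.

Lemma card_singular_le m :
  (#|[set A : 'M[F]_m.+1 | A \notin unitmx]| <= m.+1 * #|F| ^ (m * m.+2))%N.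
Proof.
have sub : [set A : 'M[F]_m.+1 | A \notin unitmx] \subset
    [set dependent_row_mx p | p in setT].
  apply/subsetP => A; rewrite inE => /singular_dependent_row[p ->].
  exact: imset_f.
apply: leq_trans (subset_leq_card sub) _.
apply: leq_trans (leq_imset_card _ _) _.
rewrite cardsT !card_prod card_ord !card_mx -mulnA -expnD.
by rewrite (_ : 1 * m + m * m.+1 = m * m.+2)%N //; lia.
Qed.

End SingularMatrices.

Section SolutionCount.
Variables (F : finFieldType) (m : nat).
Local Notation M := 'M[F]_m.+1.
Local Notation Q := #|{: M}|.
Local Notation sing := #|[set A : M | A \notin unitmx]|.

(** The number of [(x, c)] in [X * C] with [x t - b = c], as a sum of indicators so that moments
    follow by exchanging sums. *)
Definition nsol (X C : {set M}) (t b : M) : nat :=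
  (\sum_(x in X) ((x *m t - b)%R \in C))%N.

Lemma sum_nsol X C : (\sum_t \sum_b nsol X C t b = Q * (#|X| * #|C|))%N.
Proof.
transitivity (\sum_(t : M) #|X| * #|C|)%N; last by rewrite sum_nat_const.
apply: eq_bigr => t _; rewrite exchange_big /= -sum_nat_const.
apply: eq_bigr => x _; apply: (sum_mem_bij (f := fun b => x *m t - b)).
by move=> b b' /addrI /oppr_inj.
Qed.

(** Put [c = x t - b]; the other condition becomes [(y - x) t + c \in C]. For each [c] in [C],
    exactly [#|C|] matrices [t] satisfy it if [y - x] is invertible, and at most [Q] do
    otherwise. *)
Lemma sum_nsol_pair (C : {set M}) (x y : M) :
  (\sum_t \sum_b ((x *m t - b)%R \in C) * ((y *m t - b)%R \in C) <=
     #|C| ^ 2 + ((y - x)%R \notin unitmx) * (#|C| * Q))%N.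
Proof.
have -> : (\sum_t \sum_b ((x *m t - b)%R \in C) * ((y *m t - b)%R \in C) =
    \sum_(c in C) \sum_t (((y - x) *m t + c)%R \in C))%N.
  rewrite [RHS]exchange_big /=; apply: eq_bigr => t _.
  rewrite (reindex_inj (h := fun c => x *m t - c)) /=; last first.
    by move=> b b' /addrI /oppr_inj.
  rewrite [RHS]big_mkcond /=; apply: eq_bigr => c _.
  rewrite subKr mulmxBl opprB addrA addrAC.
  by case: (c \in C); rewrite ?mul1n ?mul0n.
case: (boolP (y - x \in unitmx)) => [U|_] /=.
  rewrite mul0n addn0 -mulnn -sum_nat_const leq_eqVlt; apply/orP; left.
  apply/eqP/eq_bigr => c _.
  apply: (sum_mem_bij (f := fun t => (y - x) *m t + c)) => t t' /addIr.
  exact: (can_inj (mulKmx U)).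
rewrite mul1n (leq_trans _ (leq_addl _ _)) // -sum_nat_const.
apply: leq_sum => c _; rewrite -sum1_card; apply: leq_sum => t _.
by case: (_ \in C).
Qed.

Lemma sum_nsol_sqr_le X C :
  (\sum_t \sum_b nsol X C t b ^ 2 <=
     (#|X| * #|C|) ^ 2 + #|X| * #|C| * (sing * Q))%N.
Proof.
have -> : (\sum_t \sum_b nsol X C t b ^ 2 = \sum_(x in X) \sum_(y in X)
    \sum_t \sum_b ((x *m t - b)%R \in C) * ((y *m t - b)%R \in C))%N.
  rewrite (eq_bigr (fun t => \sum_(x in X) \sum_(y in X) \sum_b
    ((x *m t - b)%R \in C) * ((y *m t - b)%R \in C)))%N; last first.
    move=> t _; rewrite (eq_bigr (fun b => \sum_(x in X) \sum_(y in X)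
      ((x *m t - b)%R \in C) * ((y *m t - b)%R \in C)))%N; last first.
      by move=> b _; rewrite -mulnn /nsol big_distrlr.
    by rewrite exchange_big; apply: eq_bigr => x _; rewrite exchange_big.
  by rewrite exchange_big; apply: eq_bigr => x _; rewrite exchange_big.
apply: (@leq_trans (\sum_(x in X) (#|X| * #|C| ^ 2 + sing * (#|C| * Q)))%N).
  apply: leq_sum => x _.
  apply: leq_trans (leq_sum _ (fun y _ => sum_nsol_pair C x y)) _.
  rewrite big_split /= sum_nat_const leq_add2l -big_distrl leq_mul2r.
  apply/orP; right; rewrite big_mkcond /=.
  (* For fixed [x], the translation [y - x] is injective in [y], so at most [sing] elements [y] of
     [X] give a singular difference. *)
  rewrite -(sum_mem_bij [set A : M | A \notin unitmx] (addIr (- x))).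
  by apply: leq_sum => y _; rewrite inE; case: (y \in X).
rewrite sum_nat_const leq_eqVlt; apply/orP; left; apply/eqP; ring.
Qed.

(** Expanding around the mean [mu], the terms in [(#|X| * #|C|) ^ 2] cancel and only the
    contribution of singular differences to the second moment remains. *)
Lemma variance_nsol_le (R : realFieldType) X C :
  \sum_p ((nsol X C p.1 p.2)%:R - (#|X| * #|C|)%:R / Q%:R) ^+ 2
    <= (#|X| * #|C| * (sing * Q))%:R :> R.
Proof.
set mu := _ / _.
have Q_neq0 : Q%:R != 0 :> R.
  by rewrite pnatr_eq0 -lt0n; apply/card_gt0P; exists 0.
under eq_bigr => p _.
  rewrite (_ : _ ^+ 2 = (nsol X C p.1 p.2)%:R ^+ 2 -
    (nsol X C p.1 p.2)%:R * (mu * 2) + mu ^+ 2); last by ring.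
  over.
rewrite big_split sumrB /= sumr_const card_prod -mulr_suml.
rewrite -natr_sum -(pair_bigA _ (nsol X C)) sum_nsol.
have -> : \sum_p (nsol X C p.1 p.2)%:R ^+ 2 =
    (\sum_t \sum_b nsol X C t b ^ 2)%N%:R :> R.
  rewrite (pair_bigA _ (fun t b => nsol X C t b ^ 2)%N) natr_sum.
  by apply: eq_bigr => p _; rewrite natrX.
have := sum_nsol_sqr_le X C; rewrite -(ler_nat R) natrD natrX.
rewrite -[mu ^+ 2 *+ _]mulr_natr [(Q * Q)%:R]natrM [(Q * _)%:R]natrM.
suff -> : Q%:R * (#|X| * #|C|)%:R * (mu * 2) = 2 * (#|X| * #|C|)%:R ^+ 2 :> R.
  suff -> : mu ^+ 2 * (Q%:R * Q%:R) = (#|X| * #|C|)%:R ^+ 2 by lra.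
  by rewrite /mu; field.
by rewrite /mu; field.
Qed.

Lemma sum_nsol_image (A B C T : {set M}) :
    {in A, forall a, a \in unitmx} ->
    {in A & B & C, forall a b c, a *m (b + c) \in T} ->
  (#|A| * #|B| * #|C| <=
     \sum_(p in setX T B) nsol [set invmx a | a in A] C p.1 p.2)%N.
Proof.
move=> A_unit ABC_T.
rewrite (eq_bigl (fun p => (p.1 \in T) && (p.2 \in B))); last first.
  by move=> p; rewrite inE.
rewrite -(pair_big _ _ (nsol _ C)) /= exchange_big /=.
rewrite mulnAC mulnC -sum_nat_const; apply: leq_sum => b bB.
rewrite /nsol exchange_big /= big_imset /=; last first.
  by move=> a a' _ _; apply: (can_inj (@invmxK _ _)).
rewrite -sum_nat_const; apply: leq_sum => a aA.
rewrite -sum1_card big_mkcond [leqRHS]big_mkcond /=.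
(* At [t = a (b + c)] the value of [invmx a *m t - b] is [c], so each [c] in [C] contributes its own
   [t] in [T]. *)
rewrite [leqRHS](reindex_inj (h := fun c => a *m (b + c))) /=; last first.
  move=> c c' /(can_inj (mulKmx (A_unit a aA))); exact: addrI.
apply: leq_sum => c _; case: ifP => // cC.
case: ifP => [_|/negP[]]; last exact: ABC_T.
by rewrite mulKmx ?A_unit // addrAC subrr add0r cC.
Qed.

End SolutionCount.

Lemma image3_mxf_density (R : realFieldType) (F : finFieldType) (m : nat)
    (A B C : {set 'M[F]_m.+1}) :
    {in A, forall a, a \in unitmx} ->
    (2 * m.+1%:R * #|F|%:R ^+ (3 * (m * m.+2) + 2)
       <= (#|A| * #|B| * #|C|)%:R :> R) ->
  2^-1 * #|F|%:R ^+ (m * m.+2).+1 <= #|image3 (@mxf F m.+1) A B C|%:R :> R.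
Proof.
move=> A_unit; set S := (#|A| * _ * _)%N; set T := image3 _ A B C.
set q : R := #|F|%:R; set k := (m * m.+2)%N => S_ge.
rewrite leNgt; apply/negP => T_lt.
have q_gt0 : 0 < q by rewrite ltr0n; apply/card_gt0P; exists 0.
have QE : #|{: 'M[F]_m.+1}|%:R = q ^+ k.+1 :> R.
  by rewrite card_mx natrX; congr (_ ^+ _); rewrite /k; lia.
set X := [set invmx a | a in A].
have cardX : #|X| = #|A| by apply: card_imset; apply: (can_inj (@invmxK _ _)).
have S_le : (S <= \sum_(p in setX T B) nsol X C p.1 p.2)%N.
  apply: sum_nsol_image => // a b c aA bB cC; rewrite inE.
  apply/existsP; exists a; rewrite aA; apply/existsP; exists b; rewrite bB.
  by apply/existsP; exists c; rewrite cC eqxx.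
move: S_le; rewrite -(ler_nat R) natr_sum => S_le.
have := variance_nsol_le R X C; rewrite QE.
set mu := _ / q ^+ _ => var.
pose f (p : 'M[F]_m.+1 * 'M[F]_m.+1) : R := (nsol X C p.1 p.2)%:R - mu.
have := sqr_sum_le_card (mem (setX T B)) f.
rewrite {1}/f sumrB sumr_const cardsX -[mu *+ _]mulr_natr.
set E := \sum_(p in _) _ in S_le *; set V := \sum_(p in _) _ => CS.
(* The squares are nonnegative, so their sum over [T * B] is at most the variance over all pairs. *)
have V_le : V <= \sum_p f p ^+ 2.
  rewrite /V big_mkcond /=; apply: ler_sum => p _.
  by case: ifP => // _; apply: sqr_ge0.
have Qk_gt0 : 0 < q ^+ k.+1 by apply: exprn_gt0.
set t : R := #|T|%:R in T_lt; set s : R := S%:R in S_ge S_le.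
have t_ge0 : 0 <= t by apply: ler0n.
have s_gt0 : 0 < s.
  by apply: lt_le_trans S_ge; rewrite !mulr_gt0 ?exprn_gt0 // ?ltr0n.
have sing_le : #|[set M : 'M[F]_m.+1 | M \notin unitmx]|%:R
    <= m.+1%:R * q ^+ k :> R.
  by rewrite -natrX -natrM ler_nat card_singular_le.
(* Density of [T] below 1/2 makes the expected count on [T * B] at most half of the actual count,
   which is at least [s]. *)
have mu_le : mu * (#|T| * #|B|)%:R <= s / 2.
  have -> : mu * (#|T| * #|B|)%:R = s * (t / q ^+ k.+1).
    by rewrite /mu /s /S /t cardX !natrM; field; rewrite gt_eqF.
  by rewrite ler_pM2l // ler_pdivrMr // ltW.
have half_le : s / 2 <= E - mu * (#|T| * #|B|)%:R by lra.
have : (s / 2) ^+ 2 <= (#|T| * #|B|)%:R *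
    (#|X| * #|C| * (#|[set M : 'M[F]_m.+1 | M \notin unitmx]| *
      #|{: 'M[F]_m.+1}|))%:R.
  apply: le_trans (le_trans _ CS) _.
    by rewrite ler_pXn2r ?nnegrE //; lra.
  by rewrite ler_wpM2l ?ler0n // (le_trans V_le).
set sg := #|[set _ | _]| in sing_le *.
have -> : (#|T| * #|B|)%:R * (#|X| * #|C| * (sg * #|{: 'M[F]_m.+1}|))%:R =
    s * (t * (sg%:R * q ^+ k.+1)).
  by rewrite -QE /s /S /t cardX !natrM; ring.
rewrite (_ : (s / 2) ^+ 2 = s * (s / 4)); last by field.
rewrite ler_pM2l // => s_le.
have : s / 4 < s / 4; last by rewrite ltxx.
apply: (le_lt_trans s_le).
apply: (@le_lt_trans _ _ (t * (m.+1%:R * q ^+ k * q ^+ k.+1))).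
  by rewrite ler_wpM2l // ler_wpM2r // ltW.
(* With [n = m.+1], the bound on [t] gives [s / 4 < n q^(3k+2) / 2], which contradicts
   [s >= 2 n q^(3k+2)]. *)
apply: (@lt_le_trans _ _
    (2^-1 * q ^+ k.+1 * (m.+1%:R * q ^+ k * q ^+ k.+1))).
  by rewrite ltr_pM2r // !mulr_gt0 ?exprn_gt0 // ?ltr0n.
rewrite ler_pdivlMr //; apply: le_trans S_ge.
rewrite (_ : (3 * k + 2 = k.+1 + k + k.+1)%N); last by lia.
by rewrite !exprD le_eqVlt; apply/orP; left; apply/eqP; field.
Qed.

Theorem theorem1p9 (R : realType) (n : nat) (hn : (0 < n)%N) :
  exists C0 c : R,
    [/\ 0 < C0, 0 < c &
      forall (F : finFieldType) (q : nat), #|F| = q -> odd q ->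
      forall A B C : {set 'M[F]_n},
        C0 * q%:R ^+ (3 * n ^ 2 - 1)%N <= (#|A| * #|B| * #|C|)%N%:R ->
        c * q%:R ^+ (n ^ 2)%N <= #|image3 (@mxf F n) A B C|%:R].
Proof.
(* Discarding singular matrices costs the product at most [n q^(3n^2-1)]; starting from [4n], at
   least the factor [2n] required by [image3_mxf_density] survives. *)
case: n hn => // m _; exists (4 * m.+1%:R), 2^-1.
split; rewrite ?invr_gt0 ?mulr_gt0 ?ltr0n // => F _ <- _ A B C.
have -> : (3 * m.+1 ^ 2 - 1 = 3 * (m * m.+2) + 2)%N by rewrite -mulnn; lia.
have -> : (m.+1 ^ 2 = (m * m.+2).+1)%N by rewrite -mulnn; lia.
set k := (m * m.+2)%N; set q : R := #|F|%:R => ABC_ge.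
have q_gt0 : 0 < q by rewrite ltr0n; apply/card_gt0P; exists 0.
pose U := A :&: [set a | a \in unitmx].
have U_unit : {in U, forall a, a \in unitmx}.
  by move=> a; rewrite !inE => /andP[].
have le_Q (D : {set 'M[F]_m.+1}) : #|D|%:R <= q ^+ k.+1.
  rewrite -natrX ler_nat (leq_trans (max_card _)) // card_mx.
  by rewrite leq_eqVlt (_ : m.+1 * m.+1 = k.+1)%N ?eqxx // /k; lia.
have AU : #|A|%:R <= #|U|%:R + m.+1%:R * q ^+ k.
  rewrite -natrX -natrM -natrD ler_nat -(cardsID [set a | a \in unitmx] A).
  rewrite leq_add2l; apply: leq_trans (card_singular_le F m).
  by apply/subset_leq_card/subsetP => a; rewrite !inE => /andP[].
have U_ge : 2 * m.+1%:R * q ^+ (3 * k + 2) <= (#|U| * #|B| * #|C|)%:R.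
  have BC_le : #|B|%:R * #|C|%:R <= q ^+ k.+1 * q ^+ k.+1.
    by apply: ler_pM; rewrite ?ler0n ?le_Q.
  have BC_ge0 : 0 <= #|B|%:R * #|C|%:R :> R by rewrite mulr_ge0 ?ler0n.
  have : #|A|%:R * (#|B|%:R * #|C|%:R) <=
      #|U|%:R * (#|B|%:R * #|C|%:R) +
      m.+1%:R * q ^+ k * (q ^+ k.+1 * q ^+ k.+1).
    apply: le_trans (ler_wpM2r BC_ge0 AU) _; rewrite mulrDl lerD2l.
    by apply: ler_wpM2l; rewrite // mulr_ge0 ?ler0n ?exprn_ge0 ?ltW.
  move: ABC_ge; rewrite !natrM -!mulrA.
  rewrite -!exprD (_ : (k + (k.+1 + k.+1) = 3 * k + 2)%N); last by lia.
  have : 0 <= m.+1%:R * q ^+ (3 * k + 2).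
    by rewrite mulr_ge0 ?ler0n ?exprn_ge0 ?ltW.
  by lra.
apply: le_trans (image3_mxf_density U_unit U_ge) _.
(* Shrinking [A] to its invertible part [U] can only shrink the image. *)
rewrite ler_nat; apply/subset_leq_card/subsetP => w; rewrite !inE.
case/existsP => a /andP[]; rewrite inE => /andP[aA _] Ha.
by apply/existsP; exists a; rewrite aA.
Qed.
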